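(* There exists a family of costs $C\in(\mathbb{R}^n)^{\otimes k}$ for which $\mathsf{MIN}_C$ and $\mathsf{AMIN}_C$ can be solved in $\mathrm{poly}(n,k)$ time, however $\mathsf{SMIN}_C$ is $\#$BIS-hard.
   Context: Notation: $[n]=\{1,\dots,n\}$; $\vec{j}=(j_1,\dots,j_k)\in[n]^k$ indexes entries of $C\in(\mathbb{R}^n)^{\otimes k}$; $\bar{\mathbb{R}}=\mathbb{R}\cup\{-\infty\}$. The softmin with parameter $\eta>0$ is $\mathrm{smin}_\eta(a_1,\dots,a_m)=-\frac1\eta\log\sum_{i=1}^me^{-\eta a_i}$ for $a_i\in\mathbb{R}\cup\{\infty\}$, with the conventions $e^{-\infty}=0$, $\log0=-\infty$. Oracles. $\mathsf{MIN}_C$: given $p=(p_1,\dots,p_k)\in\mathbb{R}^{n\times k}$, return $\min_{\vec{j}\in[n]^k}C_{\vec{j}}-\sum_{i=1}^k[p_i]_{j_i}$. $\mathsf{AMIN}_C$: given $p\in\mathbb{R}^{n\times k}$ and $\varepsilon>0$, return $\mathsf{MIN}_C(p)$ up to additive error $\varepsilon$. $\mathsf{SMIN}_C$: given $p\in\bar{\mathbb{R}}^{n\times k}$ and $\eta>0$, return $\mathrm{smin}_\eta$ over $\vec{j}\in[n]^k$ of the values $C_{\vec{j}}-\sum_{i=1}^k[p_i]_{j_i}$. The costs in the family are given through implicit representations of size $\mathrm{poly}(n,k)$ whose components have bit complexity at most $\mathrm{poly}(n,k)$; runtimes count arithmetic operations. $\#$BIS is the problem of counting the independent sets of a bipartite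 graph; $\#$BIS-hard means that a polynomial-time algorithm for the task would yield a polynomial-time algorithm for $\#$BIS. *)

(* Defs.v *)
From HB Require Import structures.
From mathcomp Require Import all_boot all_order all_algebra.
From mathcomp Require Import all_classical all_reals all_analysis.

Set Implicit Arguments.
Unset Strict Implicit.
Unset Printing Implicit Defensive.

Import Order.TTheory GRing.Theory Num.Theory.
Local Open Scope ring_scope.

(** * Computation model

    A real random-access machine whose running time counts arithmetic
    operations.  A program is a finite text of a WHILE language over two infinite
    memories: one of naturals (sizes, counters, addresses), one of exact reals.
    Two restrictions keep the unit cost honest: there is no way to turn a
    real into a natural (no floor), and the only operations on naturals are
    addition and truncated subtraction.  Constants in a program are naturals
    and rationals, never arbitrary reals. *)

Inductive nexp : Type :=
| NConst of nat
| NGet of nexp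
| NAdd of nexp & nexp
| NSub of nexp & nexp.

Inductive rexp : Type :=
| RConst of rat
| RNat of nexp
| RGet of nexp
| RAdd of rexp & rexp
| RSub of rexp & rexp
| RMul of rexp & rexp
| RDiv of rexp & rexp
| RExp of rexp
| RLn of rexp.

Inductive bexp : Type :=
| BNLt of nexp & nexp
| BRLt of rexp & rexp
| BNot of bexp
| BAnd of bexp & bexp.

Inductive cmd : Type :=
| CSkip
| CNSet of nexp & nexp
| CRSet of nexp & rexp
| CSeq of cmd & cmd
| CIf of bexp & cmd & cmd
| CWhile of bexp & cmd
| COracle of nexp & nexp.

(** Programs that use only the field operations and comparisons: no
    exponential, no logarithm and no oracle. *)
Fixpoint arith_rexp (e : rexp) : bool :=
  match e with
  | RConst _ | RNat _ | RGet _ => true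
  | RAdd e1 e2 | RSub e1 e2 | RMul e1 e2 | RDiv e1 e2 =>
      arith_rexp e1 && arith_rexp e2
  | RExp _ | RLn _ => false
  end.

Fixpoint arith_bexp (b : bexp) : bool :=
  match b with
  | BNLt _ _ => true
  | BRLt e1 e2 => arith_rexp e1 && arith_rexp e2
  | BNot b1 => arith_bexp b1
  | BAnd b1 b2 => arith_bexp b1 && arith_bexp b2
  end.

Fixpoint arith_cmd (c : cmd) : bool :=
  match c with
  | CSkip | CNSet _ _ => true
  | CRSet _ e => arith_rexp e
  | CSeq c1 c2 => arith_cmd c1 && arith_cmd c2
  | CIf b c1 c2 => [&& arith_bexp b, arith_cmd c1 & arith_cmd c2]
  | CWhile b c1 => arith_bexp b && arith_cmd c1
  | COracle _ _ => false
  end.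

Record state (R : Type) := State { nmem : nat -> nat; rmem : nat -> R }.

Definition upd (T : Type) (m : nat -> T) (i : nat) (v : T) : nat -> T :=
  fun j => if j == i then v else m j.

Definition holds_block (T : Type) (m : nat -> T) (base : nat) (l : seq T) : Prop :=
  forall (x0 : T) (i : nat), (i < size l)%N -> m (base + i)%N = nth x0 l i.

Definition write_block (T : Type) (m : nat -> T) (base : nat) (l : seq T) :
    nat -> T :=
  fun j => if (base <= j)%N then nth (m j) l (j - base) else m j.

Definition init_state (R : realType) (a : seq nat) (b : seq R) : state R :=
  State (fun i => nth 0%N a i) (fun i => nth 0 b i).

Fixpoint neval (m : nat -> nat) (e : nexp) : nat :=
  match e with
  | NConst c => c
  | NGet e1 => m (neval m e1)
  | NAdd e1 e2 => (neval m e1 + neval m e2)%N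
  | NSub e1 e2 => (neval m e1 - neval m e2)%N
  end.

Fixpoint reval (R : realType) (s : state R) (e : rexp) : R :=
  match e with
  | RConst q => ratr q
  | RNat e1 => (neval (nmem s) e1)%:R
  | RGet e1 => rmem s (neval (nmem s) e1)
  | RAdd e1 e2 => reval s e1 + reval s e2
  | RSub e1 e2 => reval s e1 - reval s e2
  | RMul e1 e2 => reval s e1 * reval s e2
  | RDiv e1 e2 => reval s e1 / reval s e2
  | RExp e1 => expR (reval s e1)
  | RLn e1 => ln (reval s e1)
  end.

Fixpoint beval (R : realType) (s : state R) (b : bexp) : bool :=
  match b with
  | BNLt e1 e2 => (neval (nmem s) e1 < neval (nmem s) e2)%N
  | BRLt e1 e2 => reval s e1 < reval s e2
  | BNot b1 => ~~ beval s b1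
  | BAnd b1 b2 => beval s b1 && beval s b2
  end.

(** [O a b out]: on the query [(a, b)] the oracle may answer [out]. *)
Definition oracle (R : Type) := seq nat -> seq R -> seq R -> Prop.

Definition no_oracle (R : Type) : oracle R := fun _ _ _ => False.

(** [exec O c s t s']: started in [s], the program [c] halts in [s'] after time
    [t].  An elementary command or a test costs 1: its expressions have a size
    fixed by the program text, so this is the number of arithmetic operations
    up to a constant factor.  An oracle call reads its query from the two
    blocks starting at the given addresses, overwrites the real block with the
    answer, and costs the length of the query, so that a query cannot be
    larger than the time spent; a query without an answer blocks. *)
Inductive exec (R : realType) (O : oracle R) :
    cmd -> state R -> nat -> state R -> Prop :=
| exec_skip s : exec O CSkip s 1 s
| exec_nset s x e :
    exec O (CNSet x e) s 1
      (State (upd (nmem s) (neval (nmem s) x) (neval (nmem s) e)) (rmem s))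
| exec_rset s x e :
    exec O (CRSet x e) s 1
      (State (nmem s) (upd (rmem s) (neval (nmem s) x) (reval s e)))
| exec_seq c1 c2 s1 s2 s3 t1 t2 :
    exec O c1 s1 t1 s2 -> exec O c2 s2 t2 s3 ->
    exec O (CSeq c1 c2) s1 (t1 + t2) s3
| exec_if b c1 c2 s t s' :
    exec O (if beval s b then c1 else c2) s t s' ->
    exec O (CIf b c1 c2) s t.+1 s'
| exec_while_false b c s :
    ~~ beval s b -> exec O (CWhile b c) s 1 s
| exec_while_true b c s1 s2 s3 t1 t2 :
    beval s1 b -> exec O c s1 t1 s2 -> exec O (CWhile b c) s2 t2 s3 ->
    exec O (CWhile b c) s1 (t1 + t2).+1 s3
| exec_oracle x y s a b out :
    O a b out ->
    holds_block (nmem s) (neval (nmem s) x) a ->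
    holds_block (rmem s) (neval (nmem s) y) b ->
    exec O (COracle x y) s (size a + size b).+1
      (State (nmem s) (write_block (rmem s) (neval (nmem s) y) out)).

(** * Computational problems *)

Record problem (R : realType) := Problem {
  inst : Type;
  psize : inst -> nat;                (* running times are polynomial in this *)
  nat_input : inst -> seq nat;
  real_input : inst -> seq R;
  correct : inst -> seq R -> Prop     (* acceptable outputs *)
}.

Definition solves_in_poly_time (R : realType) (O : oracle R) (c : cmd)
    (P : problem R) : Prop :=
  exists A d : nat, forall x : inst P,
  exists (t : nat) (s : state R) (out : seq R),
    [/\ exec O c (init_state (nat_input x) (real_input x)) t s,
        (t <= A * psize x ^ d + A)%N,
        correct x out
      & holds_block (rmem s) 0 out].

Definition poly_time_solvable (R : realType) (P : problem R) : Prop :=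
  exists c : cmd, arith_cmd c /\ solves_in_poly_time (no_oracle (R:=R)) c P.

Definition oracle_of (R : realType) (P : problem R) : oracle R :=
  fun a b out => exists x : inst P,
    [/\ a = nat_input x, b = real_input x & correct x out].

(** Polynomial-time Turing reduction: an algorithm for [P], used as a
    subroutine, yields an algorithm for [Q].  Unlike a bare implication
    between the existence of two algorithms, this cannot hold vacuously.
    Exponentials and logarithms are available to the reduction, since the
    values of a softmin are logarithms. *)
Definition poly_time_reduces (R : realType) (Q P : problem R) : Prop :=
  exists c : cmd, solves_in_poly_time (oracle_of P) c Q.

Definition flatten_mx (T : Type) (m n : nat) (M : 'M[T]_(m, n)) : seq T :=
  [seq M i j | i <- enum 'I_m, j <- enum 'I_n].

(** * Counting independent sets of bipartite graphs *)

Definition bipartite_adj (a b : nat) (E : 'M[bool]_(a, b)) :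
    rel ('I_a + 'I_b) :=
  fun x y => match x, y with
             | inl u, inr v => E u v
             | inr v, inl u => E u v
             | _, _ => false
             end.

Definition independent (V : finType) (e : rel V) (S : {set V}) : bool :=
  [forall x in S, forall y in S, ~~ e x y].

Record bipartite_graph := BipartiteGraph {
  left_size : nat;
  right_size : nat;
  edges : 'M[bool]_(left_size, right_size)
}.

Definition num_independent_sets (G : bipartite_graph) : nat :=
  #|[set S | independent (bipartite_adj (edges G)) S]|.

Definition sharpBIS (R : realType) : problem R := {|
  inst := bipartite_graph;
  psize := fun G => (left_size G + right_size G)%N;
  nat_input := fun G => [:: left_size G; right_size G];
  real_input := fun G => [seq (nat_of_bool e)%:R | e <- flatten_mx (edges G)];
  correct := fun G out => out = [:: (num_independent_sets G)%:R]
|}.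

Definition sharpBIS_hard (R : realType) (P : problem R) : Prop :=
  poly_time_reduces (sharpBIS R) P.

(** * Families of costs with implicit representations *)

(** Number of binary digits of the numerator and the denominator. *)
Definition rat_bits (q : rat) : nat :=
  (up_log 2 `|numq q|.+1 + up_log 2 `|denq q|.+1)%N.

(** [cost w] is the tensor in (R^n)^{⊗k} represented by the list [w], and
    [member n k w] says that [w] is a representation used by the family. *)
Record cost_family (R : realType) := CostFamily {
  member : nat -> nat -> seq rat -> Prop;
  cost : forall n k : nat, seq rat -> k.-tuple 'I_n -> R;
  member_gt0 : forall n k w, member n k w -> (0 < n)%N /\ (0 < k)%N;
  repr_poly : exists A d : nat, forall n k w, member n k w ->
    (size w <= A * (n + k) ^ d + A)%N /\
    (forall q, q \in w -> (rat_bits q <= A * (n + k) ^ d + A)%N)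
}.

Record cost_inst (R : realType) (F : cost_family R) := CostInst {
  ci_n : nat;
  ci_k : nat;
  ci_repr : seq rat;
  ci_member : member F ci_n ci_k ci_repr
}.

Definition tensor (R : realType) (F : cost_family R) (I : cost_inst F) :
    (ci_k I).-tuple 'I_(ci_n I) -> R :=
  @cost R F (ci_n I) (ci_k I) (ci_repr I).

Definition cost_size (R : realType) (F : cost_family R) (I : cost_inst F) : nat :=
  (ci_n I + ci_k I)%N.

Definition cost_header (R : realType) (F : cost_family R) (I : cost_inst F) :
    seq nat :=
  [:: ci_n I; ci_k I; size (ci_repr I)].

Definition cost_repr (R : realType) (F : cost_family R) (I : cost_inst F) :
    seq R :=
  [seq ratr q | q <- ci_repr I].

(** * The oracles *)

Definition is_min (R : realType) (J : Type) (f : J -> R) (v : R) : Prop :=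
  (exists j, f j = v) /\ (forall j, v <= f j).

Definition smin (R : realType) (eta : R) (J : finType) (a : J -> \bar R) : \bar R :=
  ((- eta^-1)%:E * lne (\sum_(j : J) expeR ((- eta)%:E * a j)))%E.

(** The column [i] of [p] is the vector p_i. *)
Definition reduced_cost (R : realType) (n k : nat) (C : k.-tuple 'I_n -> R)
    (p : 'M[R]_(n, k)) (j : k.-tuple 'I_n) : R :=
  C j - \sum_(i < k) p (tnth j i) i.

Definition ereduced_cost (R : realType) (n k : nat) (C : k.-tuple 'I_n -> R)
    (p : 'M[\bar R]_(n, k)) (j : k.-tuple 'I_n) : \bar R :=
  ((C j)%:E - \sum_(i < k) p (tnth j i) i)%E.

Record min_inst (R : realType) (F : cost_family R) := MinInst {
  mi_cost : cost_inst F;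
  mi_p : 'M[R]_(ci_n mi_cost, ci_k mi_cost)
}.

Definition MIN (R : realType) (F : cost_family R) : problem R := {|
  inst := min_inst F;
  psize := fun x => cost_size (mi_cost x);
  nat_input := fun x => cost_header (mi_cost x);
  real_input := fun x => cost_repr (mi_cost x) ++ flatten_mx (mi_p x);
  correct := fun x out => exists v : R,
    out = [:: v] /\ is_min (reduced_cost (tensor (I:=mi_cost x)) (mi_p x)) v
|}.

Record amin_inst (R : realType) (F : cost_family R) := AminInst {
  ai_min : min_inst F;
  ai_eps : R;
  ai_eps_gt0 : 0 < ai_eps
}.

Definition AMIN (R : realType) (F : cost_family R) : problem R := {|
  inst := amin_inst F;
  psize := fun x => cost_size (mi_cost (ai_min x));
  nat_input := fun x => cost_header (mi_cost (ai_min x));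
  real_input := fun x =>
    cost_repr (mi_cost (ai_min x)) ++ flatten_mx (mi_p (ai_min x)) ++ [:: ai_eps x];
  correct := fun x out => exists u v : R,
    [/\ out = [:: u],
        is_min (reduced_cost (tensor (I:=mi_cost (ai_min x))) (mi_p (ai_min x))) v
      & `|u - v| <= ai_eps x]
|}.

(** An extended real is stored as a flag followed by a value.  The flag 1 marks
    the one infinite value that can occur: -oo in an entry of p, and +oo in
    the value of a softmin. *)
Definition encode_ereal (R : realType) (x : \bar R) : seq R :=
  if x is r%:E then [:: 0; r] else [:: 1; 0].

Record smin_inst (R : realType) (F : cost_family R) := SminInst {
  si_cost : cost_inst F;
  si_p : 'M[\bar R]_(ci_n si_cost, ci_k si_cost);
  si_p_lty : forall i j, (si_p i j < +oo)%E;
  si_eta : R;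
  si_eta_gt0 : 0 < si_eta
}.

Definition SMIN (R : realType) (F : cost_family R) : problem R := {|
  inst := smin_inst F;
  psize := fun x => cost_size (si_cost x);
  nat_input := fun x => cost_header (si_cost x);
  real_input := fun x =>
    cost_repr (si_cost x) ++
    flatten [seq encode_ereal e | e <- flatten_mx (si_p x)] ++ [:: si_eta x];
  correct := fun x out =>
    out = encode_ereal
      (smin (si_eta x) (ereduced_cost (tensor (I:=si_cost x)) (si_p x)))
|}.

(* Main.v *)
Require Import Defs.
From mathcomp Require Import all_boot all_order all_algebra.
From mathcomp Require Import all_classical all_reals all_analysis.
From mathcomp Require Import zify lra.

Set Implicit Arguments.
Unset Strict Implicit.
Unset Printing Implicit Defensive.

Import Order.TTheory GRing.Theory Num.Theory.
Local Open Scope ring_scope.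

(** The costs have n = 2, so that an index is a set of selected vertices among
    k = a + b ones, and a bipartite graph on a + b vertices gives the cost C_j = 0
    if j selects both ends of some edge and C_j = 1 if j is independent.

    Minimization is easy because C is a minimum of few functions, each of which
    is optimized coordinate by coordinate: the constant 1 on all indices (as C
    never exceeds 1), and for each edge the constant 0 on the subcube of the
    indices that select both of its ends.  Without constraint the best index
    attains the maximum of each column p_i, and forcing the vertex i to be
    selected costs the gap gap_i = max([p_i]_0, [p_i]_1) - [p_i]_1.  Hence
      min_j C_j - sum_i [p_i]_(j_i)
        = - sum_i max([p_i]_0, [p_i]_1) + min(1, min_(uv edge) gap_u + gap_v),
    which two nested loops over the pairs (u, v) evaluate ([runs_min],
    [edge_cost_min]).  An exact minimum is in particular an approximate one.

    The softmin, in contrast, sums over all indices.  For p = 0 and eta = 1 it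
    is - ln Z with
      Z = sum_j exp(- C_j) = (2^k - N) + N exp(- 1)
        = 2^k - N (1 - exp(- 1)),
    where N is the number of independent sets ([sum_expR_edge_cost]).  One
    query thus determines N = (2^k - Z) / (1 - exp(- 1)) ([reduction_correct]).
    The query is cheap to prepare: unused memory is zero, so the edge matrix
    where it lies, followed by blank memory, already is a representation of
    the cost and an encoding of p = 0, and only eta remains to be written.

    The running times are tracked by a total-correctness logic, [runs]. *)

(** * Execution within a time bound *)

(** The memory of naturals is described by the list of its first cells, the
    others being zero: register updates then compute on explicit lists. *)
Definition runs (R : realType) (O : oracle R) (c : cmd) (l : seq nat)
    (r : nat -> R) (T : nat) (Q : seq nat -> (nat -> R) -> Prop) : Prop :=
  exists t l' r', [/\ exec O c (State (nth 0%N l) r) t (State (nth 0%N l') r'),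
    (t <= T)%N & Q l' r'].

Lemma upd_nth (l : seq nat) x v : upd (nth 0%N l) x v = nth 0%N (set_nth 0%N l x v).
Proof. by apply/funext => i; rewrite nth_set_nth. Qed.

Lemma upd_eq (T : Type) (m : nat -> T) i v j : j = i -> upd m i v j = v.
Proof. by rewrite /upd => ->; rewrite eqxx. Qed.

Lemma upd_neq (T : Type) (m : nat -> T) i v j : j != i -> upd m i v j = m j.
Proof. by rewrite /upd => /negbTE ->. Qed.

Section Runs.
Variables (R : realType) (O : oracle R).
Implicit Types (c : cmd) (l : seq nat) (r : nat -> R) (T : nat).
Implicit Types (P Q : seq nat -> (nat -> R) -> Prop).

Lemma runs_time T c l r T' Q :
  (T <= T')%N -> runs O c l r T Q -> runs O c l r T' Q.
Proof.
move=> leT [t [l' [r' [e tT Ql]]]]; exists t, l', r'.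
by split => //; apply: leq_trans leT.
Qed.

Lemma runs_skip l r Q : Q l r -> runs O CSkip l r 1 Q.
Proof. by move=> Ql; exists 1%N, l, r; split => //; apply: exec_skip. Qed.

Lemma runs_nset x e l r Q :
  Q (set_nth 0%N l (neval (nth 0%N l) x) (neval (nth 0%N l) e)) r ->
  runs O (CNSet x e) l r 1 Q.
Proof.
move=> Ql; exists 1%N.
exists (set_nth 0%N l (neval (nth 0%N l) x) (neval (nth 0%N l) e)), r.
split; [|exact: leqnn|exact: Ql].
by rewrite -upd_nth; apply: exec_nset.
Qed.

Lemma runs_rset x e l r Q :
  Q l (upd r (neval (nth 0%N l) x) (reval (State (nth 0%N l) r) e)) ->
  runs O (CRSet x e) l r 1 Q.
Proof.
move=> Ql; exists 1%N, l.
exists (upd r (neval (nth 0%N l) x) (reval (State (nth 0%N l) r) e)).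
split; [|exact: leqnn|exact: Ql].
exact: exec_rset.
Qed.

Lemma runs_seq c1 c2 T1 T2 P l r Q :
  runs O c1 l r T1 P -> (forall l r, P l r -> runs O c2 l r T2 Q) ->
  runs O (CSeq c1 c2) l r (T1 + T2) Q.
Proof.
move=> [t1 [l1 [r1 [e1 le1 P1]]]] /(_ _ _ P1) [t2 [l2 [r2 [e2 le2 Q2]]]].
exists (t1 + t2)%N, l2, r2; split=> //; last exact: leq_add.
exact: exec_seq e1 e2.
Qed.

Lemma runs_nset_seq x e c l r T Q :
  runs O c (set_nth 0%N l (neval (nth 0%N l) x) (neval (nth 0%N l) e)) r T Q ->
  runs O (CSeq (CNSet x e) c) l r T.+1 Q.
Proof.
move=> c_runs; rewrite -add1n.
apply: runs_seq (fun l' r' => @id (runs O c l' r' T Q)).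
exact: runs_nset.
Qed.

Lemma runs_rset_seq x e c l r T Q :
  runs O c l (upd r (neval (nth 0%N l) x) (reval (State (nth 0%N l) r) e)) T Q ->
  runs O (CSeq (CRSet x e) c) l r T.+1 Q.
Proof.
move=> c_runs; rewrite -add1n.
apply: runs_seq (fun l' r' => @id (runs O c l' r' T Q)).
exact: runs_rset.
Qed.

Lemma runs_if b c1 c2 l r T Q :
  runs O (if beval (State (nth 0%N l) r) b then c1 else c2) l r T Q ->
  runs O (CIf b c1 c2) l r T.+1 Q.
Proof.
move=> [t [l' [r' [e le Q']]]]; exists t.+1, l', r'; split => //.
exact: exec_if.
Qed.

(** A loop whose guard depends on the registers only: [L i] lists the registers
    before round [i], and [I i] is an invariant of the real memory. *)
Lemma runs_for b c m T (L : nat -> seq nat) (I : nat -> (nat -> R) -> Prop) r :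
  I 0%N r ->
  (forall i r, (i < m)%N -> I i r ->
     beval (State (nth 0%N (L i)) r) b /\
     runs O c (L i) r T (fun l r => l = L i.+1 /\ I i.+1 r)) ->
  (forall r, ~~ beval (State (nth 0%N (L m)) r) b) ->
  runs O (CWhile b c) (L 0%N) r (m * T.+1).+1 (fun l r => l = L m /\ I m r).
Proof.
move=> I0 step stop.
suff main n i r' : (n + i = m)%N -> I i r' ->
    runs O (CWhile b c) (L i) r' (n * T.+1).+1 (fun l r => l = L m /\ I m r).
  by apply: main; rewrite ?addn0.
elim: n i r' => [|n IHn] i r' nim Ii.
  exists 1%N, (L m), r'; move: Ii; rewrite -nim add0n => Ii; split=> //.
  by apply: exec_while_false; move: (stop r'); rewrite -nim add0n.
have [|bi [t1 [l1 [r1 [e1 le1 [El1 I1]]]]]] := step i r' _ Ii; first by lia.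
have [|t2 [l2 [r2 [e2 le2 Q2]]]] := IHn i.+1 r1 _ I1; first by lia.
exists (t1 + t2).+1, l2, r2; split=> //; last by nia.
by apply: exec_while_true e1 _ => //; rewrite El1.
Qed.

(** Needed to name registers that have not been written yet. *)
Lemma runs_pad n c l r T Q :
  runs O c (l ++ nseq n 0%N) r T Q -> runs O c l r T Q.
Proof.
rewrite /runs (_ : nth 0%N (l ++ _) = nth 0%N l) //; apply/funext => i.
by rewrite nth_cat nth_nseq if_same; case: ltnP => // ?; rewrite nth_default.
Qed.

Lemma runs_oracle x y a b out l r Q :
  O a b out ->
  holds_block (nth 0%N l) (neval (nth 0%N l) x) a ->
  holds_block r (neval (nth 0%N l) y) b ->
  Q l (write_block r (neval (nth 0%N l) y) out) ->
  runs O (COracle x y) l r (size a + size b).+1 Q.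
Proof.
move=> Oab ha hb Q'; exists (size a + size b).+1, l.
exists (write_block r (neval (nth 0%N l) y) out).
split; [|exact: leqnn|exact: Q'].
exact: exec_oracle.
Qed.

End Runs.

(** * A program for the minimum *)

Local Notation "c1 ';;' c2" := (CSeq c1 c2) (at level 61, right associativity).

Definition reg (x : nat) : nexp := NGet (NConst x).
Definition incr (x : nat) : cmd := CNSet (NConst x) (NAdd (reg x) (NConst 1)).

(** Memory layout.  The reals start with the representation w, of size s = a * k,
    followed by the two rows of p.  Register 1 holds k, register 2 holds s and
    register 3 the address of two scratch cells: the first accumulates
    - sum_i max([p_i]_0, [p_i]_1), the second the minimum over the edges, capped
    at 1.  Register 4 runs through the columns, register 5 through the
    multiples of k, register 6 is a, and registers 7, 8, 9 are u, v and
    u * (k - a) + v for the pair made of the vertices u and a + v. *)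
Definition p0_addr (i : nexp) : nexp := NAdd (reg 2) i.
Definition p1_addr (i : nexp) : nexp := NAdd (NAdd (reg 2) (reg 1)) i.
Definition acc_addr : nexp := reg 3.
Definition best_addr : nexp := NAdd (reg 3) (NConst 1).

(** One cell is skipped after p: in an approximate problem it holds the
    precision. *)
Definition scratch_cmd : cmd :=
  CNSet (NConst 3)
    (NAdd (NAdd (NAdd (reg 2) (reg 1)) (reg 1)) (NConst 1)) ;;
  CRSet acc_addr (RConst 0) ;;
  CRSet best_addr (RConst 1).

(** The column maxima overwrite the first row of p, so that a gap becomes the
    difference of the two rows. *)
Definition maxima_cmd : cmd :=
  CWhile (BNLt (reg 4) (reg 1))
   (CIf (BRLt (RGet (p0_addr (reg 4))) (RGet (p1_addr (reg 4))))
        (CRSet (p0_addr (reg 4)) (RGet (p1_addr (reg 4)))) CSkip ;;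
    CRSet acc_addr (RSub (RGet acc_addr) (RGet (p0_addr (reg 4)))) ;;
    incr 4).

(** Division of s by k, which recovers the number a of left vertices. *)
Definition divide_cmd : cmd :=
  CWhile (BNLt (reg 5) (reg 2))
   (CNSet (NConst 5) (NAdd (reg 5) (reg 1)) ;; incr 6).

Definition gap_exp (i : nexp) : rexp := RSub (RGet (p0_addr i)) (RGet (p1_addr i)).

Definition pair_exp : rexp :=
  RAdd (gap_exp (reg 7)) (gap_exp (NAdd (reg 6) (reg 8))).

Definition pair_cmd : cmd :=
  CIf (BAnd (BRLt (RConst 0) (RGet (reg 9))) (BRLt pair_exp (RGet best_addr)))
      (CRSet best_addr pair_exp) CSkip ;;
  incr 9 ;; incr 8.

Definition pairs_cmd : cmd :=
  CWhile (BNLt (reg 7) (reg 6))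
   (CWhile (BNLt (reg 8) (NSub (reg 1) (reg 6))) pair_cmd ;;
    CNSet (NConst 8) (NConst 0) ;; incr 7).

Definition min_cmd : cmd :=
  scratch_cmd ;; maxima_cmd ;; divide_cmd ;; pairs_cmd ;;
  CRSet (NConst 0) (RAdd (RGet acc_addr) (RGet best_addr)).

(** The state of a running minimum that starts at 1.  It is phrased by its two
    characteristic properties, as these are what the comparison with the
    tensor uses. *)
Definition least_capped (R : realType) (f : nat -> nat -> R) (S : rel nat) (y : R) :=
  [/\ y <= 1, forall u v, S u v -> y <= f u v
    & y = 1 \/ exists u v, S u v /\ y = f u v].

(** The pairs found to be edges after [q] entries of a matrix with [b] columns;
    a bound on [u] follows from the one on the position. *)
Definition marked (R : realType) (b : nat) (wt : nat -> R) (q : nat) : rel nat :=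
  fun u v => [&& (v < b)%N, (u * b + v < q)%N & 0 < wt (u * b + v)%N].

Lemma least_capped_marked (R : realType) (f : nat -> nat -> R) b (wt : nat -> R)
    u v y :
  (v < b)%N -> least_capped f (marked b wt (u * b + v)) y ->
  least_capped f (marked b wt (u * b + v).+1)
    (if (0 < wt (u * b + v)%N) && (f u v < y) then f u v else y).
Proof.
move=> vb [y1 yle yeq].
have seen u' v' : marked b wt (u * b + v).+1 u' v' ->
    marked b wt (u * b + v) u' v' \/
    [/\ u' = u, v' = v & 0 < wt (u * b + v)%N].
  move=> /and3P[v'b]; rewrite ltnS leq_eqVlt => /orP[/eqP eq|lt] w'.
    (* The position determines the pair, by Euclidean division. *)
    right; have := congr1 (edivn^~ b) eq; rewrite !edivn_eq // => -[<- <-].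
    by split=> //; rewrite -eq.
  by left; apply/and3P.
have widen u' v' : marked b wt (u * b + v) u' v' ->
    marked b wt (u * b + v).+1 u' v'.
  by move=> /and3P[? lt ?]; apply/and3P; split=> //; apply: leq_trans lt _.
case: ifP => [/andP[w0 fy]|/negbT skip]; split.
- by apply: le_trans (ltW fy) y1.
- move=> u' v' /seen[/yle|[-> -> //]]; exact: le_trans (ltW fy).
- by right; exists u, v; split=> //; apply/and3P.
- by [].
- move=> u' v' /seen[/yle//|[-> -> w0]].
  by move: skip; rewrite w0 /= -leNgt.
- case: yeq => [->|[u' [v' [m ->]]]]; [by left|right].
  by exists u', v'; split=> //; apply: widen.
Qed.

Definition column_max (R : realType) (x0 x1 : nat -> R) (i : nat) : R :=
  Num.max (x0 i) (x1 i).

Definition selection_gap (R : realType) (x0 x1 : nat -> R) (i : nat) : R :=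
  column_max x0 x1 i - x1 i.

(** Right vertices are numbered after the [a] left ones. *)
Definition pair_gap (R : realType) (a : nat) (x0 x1 : nat -> R) (u v : nat) : R :=
  selection_gap x0 x1 u + selection_gap x0 x1 (a + v).

Definition scratch_base (a k : nat) : nat := (a * k + k + k + 1)%N.

Section MinProgram.
Variables (R : realType) (O : oracle R) (a k : nat) (wt x0 x1 : nat -> R).
Hypotheses (k_gt0 : (0 < k)%N) (ak : (a <= k)%N).

Local Notation b := (k - a)%N.
Local Notation s := (a * k)%N.
Local Notation B := (scratch_base a k).
Local Notation top := (column_max x0 x1).
Local Notation gap := (selection_gap x0 x1).
Local Notation f := (pair_gap a x0 x1).

Definition min_input (r : nat -> R) :=
  [/\ forall q, (q < s)%N -> r q = wt q,
      forall i, (i < k)%N -> r (s + i)%N = x0 i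
    & forall i, (i < k)%N -> r (s + k + i)%N = x1 i].

Definition min_registers (i acc a' u v q : nat) : seq nat :=
  [:: 2; k; s; B; i; acc; a'; u; v; q]%N.

Definition maxima_inv (i : nat) (r : nat -> R) :=
  (forall q, (q < s)%N -> r q = wt q) /\
  (forall j, (j < k)%N -> r (s + j)%N = if (j < i)%N then top j else x0 j) /\
  (forall j, (j < k)%N -> r (s + k + j)%N = x1 j) /\
  r B = - (\sum_(0 <= j < i) top j) /\ r (B + 1)%N = 1.

Lemma runs_maxima r : maxima_inv 0 r ->
  runs O maxima_cmd (min_registers 0 0 0 0 0 0) r (k * 5).+1
    (fun l r => l = min_registers k 0 0 0 0 0 /\ maxima_inv k r).
Proof.
move=> I0; apply: (runs_for (L := fun i => min_registers i 0 0 0 0 0)) => //;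
  last by move=> ? /=; rewrite ltnn.
move=> i {I0} r' ik [Iw [I0 [I1 [Iacc Ibest]]]]; split=> //.
apply: (@runs_seq _ _ _ _ 2 2 (fun l r => l = min_registers i 0 0 0 0 0 /\
  r = upd r' (s + i)%N (top i))).
  apply: runs_if => /=.
  rewrite I0 // ltnn I1 //; case: ltP => le.
    apply: runs_rset; split=> //=; rewrite I1 // /column_max max_r //; exact: ltW.
  apply: runs_skip; split=> //; apply/funext => j; rewrite /upd.
  by case: eqP => // ->; rewrite I0 // ltnn /column_max max_l.
move=> _ _ [-> ->]; apply: runs_rset_seq; apply: runs_nset => /=.
split; first by rewrite addn1.
split=> [q qs|]; first by rewrite !upd_neq ?Iw //; rewrite /scratch_base; lia.
split=> [j jk|].
  rewrite upd_neq; last by rewrite /scratch_base; lia.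
  have [ij|ji|->] := ltngtP j i; last by rewrite upd_eq // ltnSn.
    rewrite upd_neq; last by lia.
    by rewrite I0 // ij ltnS ltnW.
  rewrite upd_neq; last by lia.
  by rewrite I0 // ltnS [(j <= i)%N]leqNgt ji [(j < i)%N]ltnNge (ltnW ji).
split=> [j jk|]; first by rewrite !upd_neq ?I1 //; rewrite /scratch_base; lia.
split; last by rewrite !upd_neq ?Ibest //; rewrite /scratch_base; lia.
rewrite upd_eq // upd_neq; last by rewrite /scratch_base; lia.
by rewrite upd_eq // Iacc big_nat_recr //= opprD.
Qed.

Lemma runs_divide r : runs O divide_cmd (min_registers k 0 0 0 0 0) r (a * 3).+1
    (fun l r' => l = min_registers k s a 0 0 0 /\ r' = r).
Proof.
apply: (runs_for (L := fun i => min_registers k (i * k) i 0 0 0)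
  (I := fun _ r' => r' = r)) => //; last by move=> ? /=; rewrite ltnn.
move=> i _ ia ->; split; first by rewrite /= ltn_pmul2r.
apply: runs_nset_seq; apply: runs_nset => /=.
by rewrite addn1 mulSnr.
Qed.

Definition pairs_inv (q : nat) (r : nat -> R) :=
  (forall q, (q < s)%N -> r q = wt q) /\
  (forall j, (j < k)%N -> r (s + j)%N = top j) /\
  (forall j, (j < k)%N -> r (s + k + j)%N = x1 j) /\
  r B = - (\sum_(0 <= j < k) top j) /\
  least_capped f (marked b wt q) (r (B + 1)%N).

Lemma runs_pair u v r : (u < a)%N -> (v < b)%N -> pairs_inv (u * b + v) r ->
  runs O pair_cmd (min_registers k s a u v (u * b + v)) r 4
    (fun l r => l = min_registers k s a u v.+1 (u * b + v.+1) /\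
       pairs_inv (u * b + v.+1) r).
Proof.
move=> ua vb [Iw [I0 [I1 [Iacc Ibest]]]].
have qs : (u * b + v < s)%N by nia.
apply: (@runs_seq _ _ _ _ 2 2 (fun l r' =>
   l = min_registers k s a u v (u * b + v) /\
   r' = upd r (B + 1) (if (0 < wt (u * b + v)%N) && (f u v < r (B + 1)%N)
                       then f u v else r (B + 1)%N))).
  have avk : (a + v < k)%N by lia.
  have uk : (u < k)%N by lia.
  apply: runs_if; rewrite /= Iw // !I0 // !I1 // -/(gap u) -/(gap (a + v)).
  rewrite -/(f u v) rmorph0.
  case: ifP => _.
    by apply: runs_rset; split=> //=; rewrite !I0 // !I1.
  apply: runs_skip; split=> //; apply/funext => j; rewrite /upd.
  by case: eqP => // ->.
move=> _ _ [-> ->]; apply: runs_nset_seq; apply: runs_nset => /=; split.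
  by rewrite !addn1 addnS.
split=> [q q_s|]; first by rewrite upd_neq ?Iw //; rewrite /scratch_base; lia.
split=> [j jk|]; first by rewrite upd_neq ?I0 //; rewrite /scratch_base; lia.
split=> [j jk|]; first by rewrite upd_neq ?I1 //; rewrite /scratch_base; lia.
split; first by rewrite upd_neq //; lia.
by rewrite upd_eq // addnS; apply: least_capped_marked.
Qed.

Lemma runs_pairs r : pairs_inv 0 r ->
  runs O pairs_cmd (min_registers k s a 0 0 0) r (a * (b * 5 + 4)).+1
    (fun l r => l = min_registers k s a a 0 (a * b) /\ pairs_inv (a * b) r).
Proof.
move=> I0; apply: (@runs_time _ _ (a * ((b * 5).+1 + 2).+1).+1); first by lia.
apply: (runs_for (L := fun u => min_registers k s a u 0 (u * b))
  (I := fun u => pairs_inv (u * b))) => //; last by move=> ? /=; rewrite ltnn.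
move=> u r' ua Iu; split=> //.
apply: (@runs_seq _ _ _ _ _ _ (fun l r => l = min_registers k s a u b (u * b + b)
   /\ pairs_inv (u * b + b) r)).
  have := @runs_for _ O (BNLt (reg 8) (NSub (reg 1) (reg 6))) pair_cmd b 4
   (fun v => min_registers k s a u v (u * b + v)) (fun v => pairs_inv (u * b + v)) r'.
  rewrite addn0; apply=> //; last by move=> ? /=; rewrite ltnn.
  by move=> v r2 vb Iv; split=> //; apply: runs_pair.
move=> _ r2 [-> Ib]; apply: runs_nset_seq; apply: runs_nset => /=.
by rewrite mulSnr addn1.
Qed.

Lemma runs_min r : min_input r ->
  runs O min_cmd [:: 2; k; s]%N r (30 * (2 + k) ^ 2 + 30)
    (fun _ r => exists2 y, r 0%N = y - \sum_(0 <= j < k) top j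
       & least_capped f (marked b wt (a * b)) y).
Proof.
move=> [Iw I0 I1].
apply: (@runs_time _ _
  (3 + ((k * 5).+1 + ((a * 3).+1 + ((a * (b * 5 + 4)).+1 + 1))))); first by nia.
apply: (@runs_seq _ _ _ _ _ _ (fun l r => l = min_registers 0 0 0 0 0 0 /\
  maxima_inv 0 r)).
  (* There are ten registers, three of which are given. *)
  apply: (runs_pad (n := 7)).
  apply: runs_nset_seq; apply: runs_rset_seq; apply: runs_rset => /=; split=> //.
  split=> [q qs|]; first by rewrite !upd_neq ?Iw //; lia.
  split=> [j jk|]; first by rewrite !upd_neq ?I0 //; lia.
  split=> [j jk|]; first by rewrite !upd_neq ?I1 //; lia.
  rewrite big_nil oppr0 [upd _ (B + 1)%N _ (B + 1)%N]upd_eq // rmorph1.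
  by split=> //; rewrite upd_neq ?upd_eq ?rmorph0 //; rewrite /scratch_base; lia.
move=> _ r1 [-> J1]; apply: (runs_seq (runs_maxima J1)).
move=> _ r2 [-> [Kw [K0 [K1 [Kacc Kbest]]]]].
apply: (runs_seq (runs_divide r2)) => _ _ [-> ->].
apply: (runs_seq (runs_pairs _)).
  split=> //; split=> [j jk|]; first by rewrite K0 // jk.
  do 2!split=> //; rewrite Kbest; split=> //; last by left.
  by move=> u v /and3P[].
move=> _ r3 [-> [_ [_ [_ [Lacc Lbest]]]]].
apply: runs_rset => /=; exists (r3 (B + 1)%N) => //.
by rewrite upd_eq // Lacc addrC.
Qed.

End MinProgram.

(** * Costs of bipartite graphs *)

(** The list [w] starts with the adjacency matrix, [a] rows by [k - a] columns;
    [u] and [v] are numbers in the common numbering of all [k] vertices. *)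
Definition graph_edge (a k : nat) (w : seq rat) (u v : nat) : bool :=
  [&& (u < a)%N, (a <= v < k)%N & w`_(u * (k - a) + (v - a)) == 1].

(** The sides of the graph are not stored: the length [a * k] of a
    representation gives [a], as the matrix is followed by [a * a] further
    entries. *)
Definition hits_edge (n k : nat) (w : seq rat) (j : k.-tuple 'I_n) : bool :=
  [exists u : 'I_k, exists v : 'I_k,
    [&& graph_edge (size w %/ k) k w u v, tnth j u == 1%N :> nat
      & tnth j v == 1%N :> nat]].

Definition edge_cost (R : realType) (n k : nat) (w : seq rat)
    (j : k.-tuple 'I_n) : R := (~~ hits_edge w j)%:R.

Definition edge_member (n k : nat) (w : seq rat) : Prop :=
  [/\ n = 2%N, (0 < k)%N, all (fun q => (q == 0) || (q == 1)) w
    & exists2 a, (a <= k)%N & size w = (a * k)%N].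

Lemma edge_member_gt0 n k w : edge_member n k w -> (0 < n)%N /\ (0 < k)%N.
Proof. by case=> ->. Qed.

Lemma edge_repr_poly : exists A d : nat, forall n k w, edge_member n k w ->
  (size w <= A * (n + k) ^ d + A)%N /\
  (forall q, q \in w -> (rat_bits q <= A * (n + k) ^ d + A)%N).
Proof.
exists 2%N, 2%N => n k w [-> _ /allP w01 [a ak ->]]; split; first by nia.
move=> q /w01 /orP[] /eqP ->; apply: (@leq_trans 2); rewrite ?leq_addl //.
Qed.

Definition edge_family (R : realType) : cost_family R :=
  CostFamily (@edge_cost R) edge_member_gt0 edge_repr_poly.

(** * The minimum of a reduced cost *)

Section EdgeMinimum.
Variables (R : realType) (a k : nat) (w : seq rat) (p : 'M[R]_(2, k)).
Variables (x0 x1 : nat -> R).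
Hypotheses (k_gt0 : (0 < k)%N) (ak : (a <= k)%N) (sw : size w = (a * k)%N).
Hypothesis w01 : all (fun q => (q == 0) || (q == 1)) w.
Hypothesis x0E : forall i : 'I_k, x0 i = p ord0 i.
Hypothesis x1E : forall i : 'I_k, x1 i = p ord_max i.

Local Notation top := (column_max x0 x1).
Local Notation gap := (selection_gap x0 x1).
Local Notation wt := (nth 0 [seq ratr q : R | q <- w]).
Local Notation marks := (marked (k - a) wt (a * (k - a))).

(** What the index [j] loses in the column [i]; apart from the cost itself, a
    reduced cost is the constant - sum_i max([p_i]_0, [p_i]_1) plus the slacks. *)
Definition slack (j : k.-tuple 'I_2) (i : 'I_k) : R := top i - p (tnth j i) i.

Lemma slack_ge0 j i : 0 <= slack j i.
Proof.
rewrite subr_ge0 /column_max x0E x1E le_max.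
have [] : tnth j i = ord0 \/ tnth j i = ord_max.
  by case: (tnth j i) => -[|[|//]] ?; [left|right]; apply: val_inj.
all: by move=> ->; rewrite lexx ?orbT.
Qed.

Lemma slack_selected j i : nat_of_ord (tnth j i) = 1%N -> slack j i = gap i.
Proof.
move=> j1; have e : tnth j i = ord_max by apply: val_inj.
by rewrite /slack e /selection_gap x1E.
Qed.

Lemma reduced_costE j : reduced_cost (edge_cost R w) p j =
  (edge_cost R w j + \sum_i slack j i) - \sum_(0 <= i < k) top i.
Proof.
by rewrite /reduced_cost big_mkord sumrB; lra.
Qed.

Lemma marks_edge u v : marks u v = graph_edge a k w u (a + v).
Proof.
rewrite /marked /graph_edge leq_addr /= ltn_subRL addKn.
case: ltnP => vk; rewrite ?andbF //=.
have -> : (u * (k - a) + v < a * (k - a))%N = (u < a)%N.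
  by apply/idP/idP => ?; nia.
case: ltnP => //= ua.
have ws : (u * (k - a) + v < size w)%N by rewrite sw; nia.
rewrite (nth_map 0) //.
have /orP[/eqP ->|/eqP ->] := allP w01 _ (mem_nth 0 ws).
  by rewrite rmorph0 ltxx.
by rewrite rmorph1 ltr01.
Qed.

Lemma size_div : (size w %/ k)%N = a.
Proof. by rewrite sw mulnK. Qed.

(** If [j] contains an edge uv, its slacks at u and v are the gaps and the others
    are nonnegative; otherwise the cost alone is already 1. *)
Lemma edge_cost_lower y j : least_capped (pair_gap a x0 x1) marks y ->
  y <= edge_cost R w j + \sum_i slack j i.
Proof.
move=> [y1 yle _]; rewrite /edge_cost.
case: (boolP (hits_edge w j)) => [|_] /=; last first.
  by apply: le_trans y1 _; rewrite lerDl sumr_ge0 // => i _; exact: slack_ge0.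
move=> /existsP[u /existsP[v]]; rewrite size_div => /and3P[uv /eqP ju /eqP jv].
have /and3P[ua /andP[av vk] _] := uv.
have := yle u (v - a)%N; rewrite marks_edge subnKC // => /(_ uv).
rewrite /pair_gap subnKC // add0r => /le_trans; apply.
rewrite (bigD1 u) //= (bigD1 v) /=; last by apply/eqP => vu; rewrite vu in av; lia.
rewrite !slack_selected // addrA lerDl sumr_ge0 // => i _; exact: slack_ge0.
Qed.

Definition greedy (S : pred 'I_k) : k.-tuple 'I_2 :=
  [tuple if S i || (p ord0 i < p ord_max i) then ord_max else ord0 | i < k].

Lemma slack_greedy (S : pred 'I_k) i : ~~ S i -> slack (greedy S) i = 0.
Proof.
move=> /negbTE Si; rewrite /slack tnth_mktuple Si /= /column_max x0E x1E.
by case: ltP => _; rewrite subrr.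
Qed.

(** The witness is the unconstrained optimum if the capped minimum is 1, and the
    optimum among the indices that select both ends of the minimizing edge
    otherwise.  In the first case its cost may be 0, so that only an inequality
    is at hand; the lower bound turns it into an equality. *)
Lemma edge_cost_attained y : least_capped (pair_gap a x0 x1) marks y ->
  exists j, edge_cost R w j + \sum_i slack j i <= y.
Proof.
move=> [_ _ [->|[u [v [uv ->]]]]].
  exists (greedy pred0); rewrite big1 ?addr0 ?ler_nat ?leq_b1 //.
    by rewrite /edge_cost; case: hits_edge; rewrite ?ler01.
  by move=> i _; apply: slack_greedy.
rewrite marks_edge in uv; have /and3P[ua /andP[_ vk] _] := uv.
have uk : (u < k)%N := leq_trans ua ak.
pose u' := Ordinal uk; pose v' := Ordinal vk; pose S := pred2 u' v'.
have vu : v' != u' by rewrite -val_eqE /=; lia.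
have sel i : S i -> nat_of_ord (tnth (greedy S) i) = 1%N.
  by move=> Si; rewrite tnth_mktuple Si.
exists (greedy S); rewrite /edge_cost.
have -> : hits_edge w (greedy S).
  apply/existsP; exists u'; apply/existsP; exists v'.
  by rewrite size_div uv !sel //= eqxx ?orbT.
rewrite add0r (bigD1 u') //= (bigD1 v') //= big1 ?addr0.
  by rewrite !slack_selected // sel //= eqxx ?orbT.
by move=> i /andP[iu iv]; rewrite slack_greedy //= negb_or iu.
Qed.

Lemma edge_cost_min y : least_capped (pair_gap a x0 x1) marks y ->
  is_min (reduced_cost (edge_cost R w) p) (y - \sum_(0 <= i < k) top i).
Proof.
move=> ly; split=> [|j]; last by rewrite reduced_costE lerB // edge_cost_lower.
have [j jy] := edge_cost_attained ly; exists j; rewrite reduced_costE.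
by congr (_ - _); apply/le_anti; rewrite jy edge_cost_lower.
Qed.

End EdgeMinimum.

(** * Minimization and approximate minimization are easy *)

Lemma nth_allpairs (S T U : Type) (f : S -> T -> U) x0 s0 t0 (s : seq S)
    (t : seq T) i j : (i < size s)%N -> (j < size t)%N ->
  nth x0 [seq f x y | x <- s, y <- t] (i * size t + j) = f (nth s0 s i) (nth t0 t j).
Proof.
elim: s i => [//|x s IHs] [|i] /=; rewrite nth_cat size_map => is_ jt.
  by rewrite mul0n add0n jt (nth_map t0).
by rewrite mulSn -addnA ltnNge leq_addr /= addKn IHs.
Qed.

Lemma nth_flatten_mx (T : Type) (x0 : T) m n (M : 'M[T]_(m, n)) (i : 'I_m) (j : 'I_n) :
  nth x0 (flatten_mx M) (i * n + j) = M i j.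
Proof.
have := @nth_allpairs _ _ _ (fun i j => M i j) x0 i j (enum 'I_m) (enum 'I_n) i j.
by rewrite !size_enum_ord !nth_ord_enum; apply.
Qed.

Lemma size_flatten_mx (T : Type) m n (M : 'M[T]_(m, n)) :
  size (flatten_mx M) = (m * n)%N.
Proof. by rewrite size_allpairs !size_enum_ord. Qed.

(** The real memory may go on after p by an arbitrary [tail], which serves the
    exact problem (empty tail) and the approximate one (the precision). *)
Lemma min_cmd_correct (R : realType) (I : min_inst (edge_family R)) (tail : seq R) :
  exists t s v,
  [/\ exec (@no_oracle R) min_cmd
        (init_state (cost_header (mi_cost I))
          (cost_repr (mi_cost I) ++ flatten_mx (mi_p I) ++ tail)) t s,
      (t <= 30 * cost_size (mi_cost I) ^ 2 + 30)%N,
      is_min (reduced_cost (tensor (I := mi_cost I)) (mi_p I)) v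
    & holds_block (rmem s) 0 [:: v]].
Proof.
case: I => -[n k w [n2 k0 w01 [a ak sw]]] /= p; subst n.
rewrite /init_state /cost_header /cost_repr /cost_size /tensor /= sw.
pose x0 i := nth 0 (flatten_mx p) i.
pose x1 i := nth 0 (flatten_mx p) (k + i).
set r := (X in State _ X).
have rin : min_input a k (nth 0 [seq ratr q : R | q <- w]) x0 x1 r.
  rewrite /min_input /r; split=> [q q_s|i ik|i ik].
  - by rewrite nth_cat size_map sw q_s.
  - rewrite nth_cat size_map sw ltnNge leq_addr /= addKn nth_cat.
    by rewrite size_flatten_mx ifT //; lia.
  - rewrite nth_cat size_map sw -addnA ltnNge leq_addr /= addKn nth_cat.
    by rewrite size_flatten_mx ifT //; lia.
have [t [l [r' [ex le [y y0 ly]]]]] := runs_min (@no_oracle R) k0 ak rin.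
exists t, (State (nth 0%N l) r'), (r' 0%N); split=> //.
  rewrite y0; apply: edge_cost_min ly => // i.
    by rewrite /x0 -(nth_flatten_mx 0 p ord0 i).
  by rewrite /x1 -(nth_flatten_mx 0 p ord_max i) mul1n.
by move=> z [].
Qed.

Lemma min_easy (R : realType) : poly_time_solvable (MIN (edge_family R)).
Proof.
exists min_cmd; split=> //; exists 30%N, 2%N => I.
have [t [s [v [ex le vmin hv]]]] := min_cmd_correct I [::].
by exists t, s, [:: v]; split=> //=; [rewrite cats0 in ex|exists v].
Qed.

Lemma amin_easy (R : realType) : poly_time_solvable (AMIN (edge_family R)).
Proof.
exists min_cmd; split=> //; exists 30%N, 2%N => I.
have [t [s [v [ex le vmin hv]]]] := min_cmd_correct (ai_min I) [:: ai_eps I].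
exists t, s, [:: v]; split=> //=; exists v, v; split=> //.
by rewrite subrr normr0 ltW // ai_eps_gt0.
Qed.

(** * The softmin counts independent sets *)

Definition selection (a b : nat) (S : {set 'I_a + 'I_b}) : (a + b).-tuple 'I_2 :=
  [tuple if fintype.split i \in S then ord_max else ord0 | i < a + b].

(** The padding brings the length to [a * (a + b)], from which [a] is recovered. *)
Definition edge_weights (a b : nat) (E : 'M[bool]_(a, b)) : seq rat :=
  [seq (nat_of_bool e)%:R | e <- flatten_mx E] ++ nseq (a * a) 0.

Lemma size_edge_weights a b (E : 'M[bool]_(a, b)) :
  size (edge_weights E) = (a * (a + b))%N.
Proof. by rewrite size_cat size_map size_flatten_mx size_nseq addnC mulnDr. Qed.

Lemma edge_weights_member a b (E : 'M[bool]_(a, b)) : (0 < a + b)%N ->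
  edge_member 2 (a + b) (edge_weights E).
Proof.
move=> ab; split=> //; last by exists a; rewrite ?leq_addr ?size_edge_weights.
rewrite all_cat all_nseq eqxx orbT andbT all_map; apply/allP => e _ /=.
by case: e.
Qed.

Lemma tnth_selection a b (S : {set 'I_a + 'I_b}) (x : 'I_a + 'I_b) :
  (tnth (selection S) (unsplit x) == 1%N :> nat) = (x \in S).
Proof. by rewrite tnth_mktuple unsplitK; case: ifP. Qed.

Lemma graph_edge_weights a b (E : 'M[bool]_(a, b)) (x y : 'I_a + 'I_b) :
  graph_edge a (a + b) (edge_weights E) (unsplit x) (unsplit y) =
  if (x, y) is (inl u, inr v) then E u v else false.
Proof.
rewrite /graph_edge; case: x => u; last by rewrite /= ltnNge leq_addr.
case: y => v /=; first by rewrite [(a <= v)%N]leqNgt (ltn_ord v) andbF.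
rewrite ltn_ord leq_addr ltn_add2l ltn_ord !addKn /=.
have lt : (u * b + v < a * b)%N by have := ltn_ord u; have := ltn_ord v; nia.
rewrite nth_cat size_map size_flatten_mx lt (nth_map false) ?size_flatten_mx //.
by rewrite nth_flatten_mx; case: (E u v).
Qed.

Lemma hits_edge_selection a b (E : 'M[bool]_(a, b)) (S : {set 'I_a + 'I_b}) :
  (0 < a + b)%N ->
  hits_edge (edge_weights E) (selection S) =
  ~~ independent (bipartite_adj E) S.
Proof.
move=> ab; rewrite /hits_edge size_edge_weights mulnK //.
apply/idP/idP => [/existsP[i /existsP[j]]|].
  rewrite -[i]splitK -[j]splitK !tnth_selection => /and3P[].
  rewrite graph_edge_weights.
  case: (fintype.split i) (fintype.split j) => [u|//] [//|v] uv uS vS.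
  apply/negP => /forall_inP/(_ _ uS)/forall_inP/(_ _ vS) /=.
  by rewrite uv.
rewrite negb_forall_in => /exists_inP[x xS].
rewrite negb_forall_in => /exists_inP[y yS]; rewrite negbK => xy.
have [u [v [uS vS uv]]] : exists u v, [/\ inl u \in S, inr v \in S & E u v].
  by case: x y xy xS yS => u [] v //= uv ? ?; [exists u, v|exists v, u].
apply/existsP; exists (unsplit (inl u)); apply/existsP; exists (unsplit (inr v)).
by rewrite !tnth_selection uS vS graph_edge_weights uv.
Qed.

Lemma selection_bij a b : bijective (@selection a b).
Proof.
apply: inj_card_bij => [S S' eqS|]; last first.
  rewrite card_tuple !card_ord -cardsT -powersetT card_powerset cardsT.
  by rewrite card_sum !card_ord.
by apply/setP => x; rewrite -!tnth_selection eqS.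
Qed.

(** Selections of vertices and 0-1 indices are in bijection, and the cost 1 is
    paid by the independent ones. *)
Lemma card_no_hit a b (E : 'M[bool]_(a, b)) : (0 < a + b)%N ->
  #|[pred j : (a + b).-tuple 'I_2 | ~~ hits_edge (edge_weights E) j]| =
  num_independent_sets (BipartiteGraph E).
Proof.
move=> ab; rewrite /num_independent_sets.
rewrite -(on_card_preimset (f := @selection a b)); last first.
  by apply: onW_bij; apply: selection_bij.
by apply: eq_card => S; rewrite !inE hits_edge_selection // negbK.
Qed.

(** An independent index contributes exp(- 1) and any other one contributes 1. *)
Lemma sum_expR_edge_cost (R : realType) a b (E : 'M[bool]_(a, b)) : (0 < a + b)%N ->
  \sum_(j : (a + b).-tuple 'I_2) expR (- edge_cost R (edge_weights E) j) =
  2 ^+ (a + b) - (num_independent_sets (BipartiteGraph E))%:R * (1 - expR (- 1)).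
Proof.
move=> ab.
transitivity (\sum_(j : (a + b).-tuple 'I_2)
   (1 - (~~ hits_edge (edge_weights E) j)%:R * (1 - expR (- 1))) : R).
  apply: eq_bigr => j _; rewrite /edge_cost; case: hits_edge => /=.
    by rewrite oppr0 expR0 mul0r subr0.
  by rewrite mul1r opprB addrC subrK.
rewrite sumrB -mulr_suml sumr_const card_tuple card_ord natrX.
rewrite -natr_sum -(card_no_hit E ab) -sum1_card [in RHS]big_mkcond /=.
by congr (_ - _%:R * _); apply: eq_bigr => j _; rewrite inE; case: hits_edge.
Qed.

Lemma smin_edge_cost (R : realType) k (w : seq rat) :
  let Z := \sum_(j : k.-tuple 'I_2) expR (- edge_cost R w j) in
  0 < Z /\
  smin 1 (ereduced_cost (@edge_cost R 2 k w) (const_mx 0%E)) = (- ln Z)%:E.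
Proof.
move=> Z; have Z0 : 0 < Z.
  by rewrite /Z (bigD1 [tuple ord0 | i < k]) //= ltr_pwDl ?expR_gt0 // sumr_ge0 //.
split=> //; rewrite /smin invr1.
have -> : (\sum_(j : k.-tuple 'I_2) expeR ((- 1)%:E *
    ereduced_cost (@edge_cost R 2 k w) (const_mx 0%E) j) = Z%:E)%E.
  rewrite -sumEFin; apply: eq_bigr => j _; rewrite /ereduced_cost big1 => [|i _].
    by rewrite sube0 -EFinM /= mulN1r.
  by rewrite mxE.
by rewrite lne_EFin // -EFinM mulN1r.
Qed.

(** * The reduction *)

(** Registers 1, 2, 3 end up as the header (2, k, s) of the query, with
    s = a * k computed by repeated addition.  The matrix p has 2 * k entries
    encoded by two cells each, so that eta lies at s + 4 * k.  The answer - ln Z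
    is at address 1, after its flag, and 2^k is computed as exp(k ln 2).  The
    graph without vertices is treated apart, as a tensor has k > 0. *)
Definition reduction_cmd : cmd :=
  CNSet (NConst 2) (NAdd (reg 0) (reg 1)) ;;
  CIf (BNLt (NConst 0) (reg 2))
   (CWhile (BNLt (reg 4) (reg 0))
      (CNSet (NConst 3) (NAdd (reg 3) (reg 2)) ;; incr 4) ;;
    CNSet (NConst 1) (NConst 2) ;;
    CRSet (NAdd (NAdd (NAdd (reg 3) (reg 2)) (NAdd (reg 2) (reg 2))) (reg 2))
      (RConst 1) ;;
    COracle (NConst 1) (NConst 0) ;;
    CRSet (NConst 0)
      (RDiv (RSub (RExp (RMul (RNat (reg 2)) (RLn (RConst 2))))
                  (RExp (RSub (RConst 0) (RGet (NConst 1)))))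
            (RSub (RConst 1) (RExp (RConst (-1))))))
   (CRSet (NConst 0) (RConst 1)).

Lemma flatten_encode_const0 (R : realType) m n :
  flatten [seq encode_ereal e | e <- flatten_mx (const_mx 0%E : 'M[\bar R]_(m, n))]
  = nseq (m * n * 2) 0.
Proof.
have -> : flatten_mx (const_mx 0%E : 'M[\bar R]_(m, n)) = nseq (m * n) 0%E.
  rewrite -[in RHS](size_enum_ord m) -[in RHS](size_enum_ord n) /flatten_mx.
  elim: (enum 'I_m) => //= i s ->; rewrite mulSn nseqD; congr (_ ++ _).
  by elim: (enum 'I_n) => //= j t ->; rewrite mxE.
by elim: (m * n)%N => //= i ->.
Qed.

Lemma reduction_correct (R : realType) a b (E : 'M[bool]_(a, b)) :
  runs (oracle_of (SMIN (edge_family R))) reduction_cmd [:: a; b]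
    (nth 0 [seq (nat_of_bool e)%:R | e <- flatten_mx E])
    (20 * (a + b) ^ 2 + 20)
    (fun _ r => r 0%N = (num_independent_sets (BipartiteGraph E))%:R).
Proof.
set r0 := nth 0 _; set N := num_independent_sets _.
have [ab0|ab] := posnP (a + b).
  apply: (@runs_time _ _ 3); first by lia.
  apply: runs_nset_seq; apply: runs_if => /=; rewrite ab0 /=.
  apply: runs_rset => /=; rewrite upd_eq // rmorph1.
  suff -> : N = 1%N by [].
  rewrite /N /num_independent_sets -(cards1 (finset.set0 : {set 'I_a + 'I_b})).
  have no (x : 'I_a + 'I_b) : False by case: x => -[i ?]; lia.
  apply: eq_card => S; rewrite !inE; have -> : S = finset.set0.
    by apply/setP => x; case: (no x).
  by rewrite eqxx; apply/forall_inP => x; case: (no x).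
set k := (a + b)%N in ab *; set s := (a * k)%N.
pose w := edge_weights E.
have sw : size w = s by rewrite size_edge_weights.
pose C : cost_inst (edge_family R) :=
  CostInst (F := edge_family R) (edge_weights_member E ab).
have p_lty i j : ((const_mx 0%E : 'M[\bar R]_(2, k)) i j < +oo)%E by rewrite mxE ltry.
pose x := SminInst (si_cost := C) p_lty (@ltr01 R).
have [Z0 sminE] := smin_edge_cost R k w.
rewrite sum_expR_edge_cost // -/N in Z0 sminE.
set Z := (X in 0 < X) in Z0 sminE.
apply: (@runs_time _ _
    ((a * 3).+1 + ((3 + (s + (2 * k * 2 + 1))).+1 + 1).+2).+2).
  by rewrite /s; nia.
apply: (runs_pad (n := 3)).
apply: runs_nset_seq; apply: runs_if; rewrite /= -/k ab.
apply: (@runs_seq _ _ _ _ _ _ (fun l r => l = [:: a; b; k; s; a] /\ r = r0)).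
  apply: (runs_for (L := fun i => [:: a; b; k; (i * k)%N; i])
    (I := fun _ r => r = r0)) => //; last by move=> ? /=; rewrite ltnn.
  move=> i _ ia ->; split=> //.
  by apply: runs_nset_seq; apply: runs_nset => /=; rewrite addn1 mulSnr.
move=> _ _ [-> ->]; apply: runs_nset_seq; apply: runs_rset_seq => /=.
apply: (@runs_seq _ _ _ _ _ 1 (fun l r => l = [:: a; 2; k; s; a]%N /\
  r 1%N = - ln Z)).
  have -> : (3 + (s + (2 * k * 2 + 1)))%N =
      (size (nat_input (p := SMIN (edge_family R)) x) +
       size (real_input (p := SMIN (edge_family R)) x))%N.
    rewrite /= /cost_repr /= flatten_encode_const0 !size_cat size_map sw.
    by rewrite size_nseq.
  apply: (runs_oracle (out := [:: 0; - ln Z])).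
  - by exists x; split=> //=; rewrite /tensor /= sminE.
  - by move=> d [|[|[|]]] //= _; rewrite -?sw.
  (* The memory is the query: E, zeros for the padding and for p, then eta. *)
  - move=> d i; rewrite add0n /= flatten_encode_const0 !size_cat size_map sw.
    rewrite size_nseq /= nth_cat size_map sw => ilt.
    have [i_s|s_i] := ltnP i s.
      rewrite upd_neq; last by lia.
      rewrite (nth_map 0) ?sw // /w nth_cat size_map size_flatten_mx.
      case: ltnP => i_ab.
        by rewrite /r0 !(nth_map false) ?size_flatten_mx // ratr_nat.
      rewrite nth_nseq if_same rmorph0 /r0 nth_default //.
      by rewrite size_map size_flatten_mx.
    rewrite nth_cat size_nseq nth_nseq; case: ltnP => i_lt.
      rewrite upd_neq; last by lia.
      rewrite /r0 nth_default // size_map size_flatten_mx.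
      by apply: leq_trans s_i; rewrite /s /k; nia.
    have -> : (i = s + 2 * k * 2)%N by lia.
    rewrite upd_eq; last by lia.
    by rewrite addKn subnn rmorph1.
  by split.
move=> _ r [-> r1]; apply: runs_rset; rewrite /= upd_eq // r1 !rmorphN !rmorph1.
rewrite rmorph_nat rmorph0 sub0r opprK lnK ?posrE // expRM_natl lnK ?posrE ?ltr0n //.
rewrite /Z opprB addrCA subrr addr0 mulfK; first by [].
by rewrite subr_eq0 eq_sym lt_eqF // expR_lt1 oppr_lt0 ltr01.
Qed.

Lemma smin_hard (R : realType) : sharpBIS_hard (SMIN (edge_family R)).
Proof.
exists reduction_cmd, 20%N, 2%N => -[a b E] /=.
have [t [l [r [ex le r0]]]] := reduction_correct R E.
exists t, (State (nth 0%N l) r), [:: r 0%N]; split=> //; first by rewrite r0.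
by move=> z [].
Qed.

Theorem lemma3p7 (R : realType) :
  exists F : cost_family R,
    [/\ poly_time_solvable (MIN F),
        poly_time_solvable (AMIN F)
      & sharpBIS_hard (SMIN F)].
Proof.
by exists (edge_family R); split;
  [exact: min_easy|exact: amin_easy|exact: smin_hard].
Qed.
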